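(* Let $\kappa$ be a cardinal number smaller than $\mathfrak{d}$. Let $\mathcal{U}_1\supseteq\mathcal{U}_2\supseteq\cdots$ be countable point-infinite covers of $\kappa$ (by arbitrary subsets of $\kappa$), each having no finite subcover. Let $k\in\mathbb{N}$, and let $\chi_1\colon P(\kappa)\to\{1,\dots,k\}$ and $\chi_2\colon[P(\kappa)]^2\to\{1,\dots,k\}$ be arbitrary finite colorings of the sets $P(\kappa)$ and $[P(\kappa)]^2$. Then there are nonempty, pairwise disjoint, finite sets $\mathcal{F}_1\subseteq\mathcal{U}_1,\ \mathcal{F}_2\subseteq\mathcal{U}_2,\dots$ such that the sets $A_n:=\bigcup\mathcal{F}_n$, for $n\in\mathbb{N}$, have the following properties: (1) Every finite subset of $\kappa$ is contained in some set $A_n$. (2) For all nonempty finite sets $F<H$ of natural numbers, the sets $\bigcup_{n\in F}A_n$ and $\bigcup_{n\in H}A_n$ are distinct. (3) All sets $\bigcup_{n\in F}A_n$, for nonempty finite sets $F\subseteq\mathbb{N}$, have the same color (under $\chi_1$). (4) All sets $\{\bigcup_{n\in F}A_n,\ \bigcup_{n\in H}A_n\}$, for nonempty finite sets $F<H$ of natural numbers, have the same color (under $\chi_2$). Moreover, if $\mathcal{U}_1=\{B_1,B_2,\dots\}$ is enumerated without repetitions, the sets $\mathcal{F}_n$ may be chosen so that, in addition, the sets $F_n:=\{m\in\mathbb{N}: B_m\in\mathcal{F}_n\}$ satisfy $F_1<F_2<\cdots$.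
   Context: $\mathfrak{d}$ is the minimal cardinality of a dominating family $D\subseteq\mathbb{N}^{\mathbb{N}}$, that is, a family such that for each $f\in\mathbb{N}^{\mathbb{N}}$ there is $g\in D$ with $f(n)\le g(n)$ for all $n$. The cardinal $\kappa$ is regarded as a set of cardinality $\kappa$, and $P(\kappa)$ is its power set. A cover of a set is point-infinite if every point of the set is contained in infinitely many members of the cover. For a set $T$, $[T]^2$ is the set of all 2-element subsets of $T$. For nonempty finite sets $F,H\subseteq\mathbb{N}$, $F<H$ means that every element of $F$ is smaller than every element of $H$. The common color in (3) and the common color in (4) need not be equal. *)

(* Defs.v *)
From mathcomp Require Import all_boot.
From mathcomp Require Import all_classical.

Set Implicit Arguments.
Unset Strict Implicit.
Unset Printing Implicit Defensive.

Local Open Scope classical_set_scope.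
Local Open Scope card_scope.

Definition card_lt (T U : Type) (A : set T) (B : set U) : Prop :=
  (A #<= B) /\ ~ (B #<= A).

(* Any nonempty class of subsets of T has a member of least cardinality. *)
Lemma exists_card_min (T : Type) (P : set (set T)) : P !=set0 ->
  exists2 D, P D & forall E, P E -> D #<= E.
Proof.
move=> [D0 PD0].
pose I := {D : set T | P D}.
pose Q (A : set (I -> T)) := (forall g i, A g -> sval i (g i)) /\
  (forall g h i, A g -> A h -> g i = h i -> g = h).
have [F QF totF|A [[AD Ainj] Amax]] := @Zorn_bigcup _ Q.
  split=> [g i [X FX Xg]|g h i [X FX Xg] [Y FY Yh]].
    by have [+ _] := QF _ FX; exact.
  have [XY|YX] := totF _ _ FX FY.
    by have [_] := QF _ FY; apply=> //; exact: XY.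
  by have [_] := QF _ FX; apply=> //; exact: YX.
have [i Ai] : exists i : I, sval i `<=` (fun g => g i) @` A.
  apply: contrapT => /forallNP noi.
  have /choice[g0 g0P] : forall i : I, exists x, sval i x /\
      ~ ((fun g => g i) @` A) x.
    by move=> i; apply: contrapT => /forallNP nx; apply: (noi i) => x ix;
      apply: contrapT => xA; exact: (nx x).
  apply: (Amax (A `|` [set g0])).
    split; first by move=> x; left.
    move=> AA; have [_] := g0P (exist _ D0 PD0); apply.
    by exists g0 => //; apply: AA; right.
  split=> [g i [/AD|->]|g h i]; [exact|by have [] := g0P i|].
  have [_ g0A] := g0P i.
  case=> [Ag|->] [Ah|->] // gh; first exact: Ainj gh.
    by case: g0A; exists g.
  by case: g0A; exists h.
exists (sval i); first exact: svalP.
move=> E PE; pose j : I := exist _ E PE.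
apply: (card_le_trans (subset_card_le Ai)).
apply: (card_le_trans (card_image_le _ _)).
have injj : {in A &, injective (fun g : I -> T => g j)}.
  by move=> g h /set_mem Ag /set_mem Ah; exact: Ainj.
have /card_esym := inj_card_eq injj.
rewrite card_eq_le => /andP[+ _] => /card_le_trans; apply.
by apply: subset_card_le => _ [g Ag <-]; exact: (AD g j).
Qed.

(* Domination is everywhere, not just for all but finitely many n. *)
Definition dominating (D : set (nat -> nat)) : Prop :=
  forall f : nat -> nat, exists2 g, D g & forall n, f n <= g n.

Lemma exists_min_dominating : exists2 D, dominating D &
  forall E, dominating E -> D #<= E.
Proof. by apply: exists_card_min; exists setT => f; exists f. Qed.

(* The cardinal d, represented by a dominating family of least cardinality;
   only the cardinality of this set is meaningful. *)
Definition frak_d : set (nat -> nat) := s2val (cid2 exists_min_dominating).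

Lemma frak_d_dominating : dominating frak_d.
Proof. exact: s2valP. Qed.

Lemma frak_d_min (E : set (nat -> nat)) : dominating E -> frak_d #<= E.
Proof. exact: (s2valP' (cid2 exists_min_dominating)). Qed.

Definition is_cover (K : Type) (U : set (set K)) : Prop := cover U id = setT.

Definition point_infinite (K : Type) (U : set (set K)) : Prop :=
  forall x : K, infinite_set [set X | U X /\ X x].

Definition has_finite_subcover (K : Type) (U : set (set K)) : Prop :=
  exists V : set (set K), [/\ V `<=` U, finite_set V & is_cover V].

Definition two_subsets (T : Type) : set (set T) := [set S | S #= `I_2].
Arguments two_subsets T : clear implicits.

Definition fin_nonempty (F : set nat) : Prop := finite_set F /\ F !=set0.

Definition set_before (F H : set nat) : Prop :=
  forall m n, F m -> H n -> m < n.

Definition union_over (K : Type) (A : nat -> set K) (F : set nat) : set K :=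
  \bigcup_(n in F) A n.

Definition disjoint_selection (K : Type) (U Fam : nat -> set (set K)) : Prop :=
  [/\ forall n, Fam n `<=` U n, forall n, finite_set (Fam n),
      forall n, Fam n !=set0 & trivIset setT Fam].

(* The last clause also asserts that {A_F, A_H} has exactly two elements, so
   that chi2 applies to it. *)
Definition hindman_ramsey (K : Type) (k : nat) (chi1 : set K -> 'I_k)
    (chi2 : two_subsets (set K) -> 'I_k) (A : nat -> set K) : Prop :=
  [/\ forall S : set K, finite_set S -> exists n, S `<=` A n,
      forall F H, fin_nonempty F -> fin_nonempty H -> set_before F H ->
        union_over A F <> union_over A H,
      exists c, forall F, fin_nonempty F -> chi1 (union_over A F) = c &
      exists c, forall F H, fin_nonempty F -> fin_nonempty H ->
        set_before F H ->
        exists2 p : two_subsets (set K),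
          val p = [set union_over A F; union_over A H] & chi2 p = c].

(* Main.v *)
Require Import Defs.
From mathcomp Require Import all_boot.
From mathcomp Require Import all_classical.

(** Enumerate U_0 as B_0, B_1, ... A nonempty word v over nat stands for the
    finite subfamily of the B_m with m in v; concatenation of words becomes
    union of the sets B_v.  A sequence of words g is called gamma when every
    point of K lies in B_(g j) for all but finitely many j.  Initial segments
    of a tail of U_n form such a sequence, because U_n is point-infinite.

    Idempotent ultrafilter.  The sets of words that eventually contain every
    gamma sequence with letters taken from a far enough tail of a late enough
    cover form a proper filter (gamma_filter).  Prefixing a fixed word to a
    gamma sequence gives a gamma sequence, hence this filter is idempotent for
    concatenation.  A maximal idempotent filter is an ultrafilter
    (maximal_idempotent_ultra), so the filter extends to an idempotent
    ultrafilter p.  Since a subsequence of a gamma sequence is again gamma,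
    every member of p contains a whole gamma sequence.

    Milliken-Taylor.  By pigeonhole, p-almost all words have one chi1-color,
    and for p-almost all u there is one color of the pairs {B_u, B_v} for
    p-almost all v.  The Galvin-Glazer construction
    (milliken_taylor_tree) turns this into a game: at each turn the player is
    offered a member of p, and any sequence w_0, w_1, ... of words chosen from
    the offered sets has all the required color properties.  The sets B_u and
    B_v are distinct since B_v is made to contain a point outside B_u, which
    exists because no finite subfamily covers K.

    Domination.  From every offered set only a gamma sequence is considered, so
    that a move is an index j, and every finite list S of points has a
    bound above which all moves produce a set containing S.  If every infinite
    play stayed below the bounds of some S at all turns, the maxima of these
    bounds over the finitely many bounded positions would give a dominating
    family indexed by the finite lists of points (unbounded_play).  K is
    infinite and there are only |K| < d such lists (card_seq_le), so some play
    captures every finite set. *)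

Set Implicit Arguments.
Unset Strict Implicit.
Unset Printing Implicit Defensive.

Local Open Scope classical_set_scope.
Local Open Scope card_scope.

(** * Idempotent ultrafilters *)

Section IdempotentFilters.
Variables (T : Type) (op : T -> T -> T).

(** On ultrafilters this is the usual extension of [op] to the Stone-Cech
    compactification of [T]. *)
Definition filter_mul (F G : set_system T) : set_system T :=
  [set D | F [set x | G (op x @^-1` D)]].

(** Inclusion rather than equality: it already makes the ultrafilters above [F]
    a subsemigroup, and it passes to unions of chains. *)
Definition idempotent_filter (F : set_system T) : Prop := F `<=` filter_mul F F.

Lemma filter_mul_proper (F G : set_system T) :
  ProperFilter F -> ProperFilter G -> ProperFilter (filter_mul F G).
Proof.
move=> FF GF; apply: Build_ProperFilter_ex.
  move=> D; rewrite /filter_mul /= => /filter_ex[x /filter_ex[y]].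
  by exists (op x y).
split=> [|D E FD FE|D E DE FD].
- by rewrite /filter_mul /=; apply: filterE => x; exact: filterT.
- rewrite /filter_mul /= in FD FE *.
  by apply: filterS2 FD FE => x; exact: filterI.
- rewrite /filter_mul /= in FD *.
  by apply: filterS FD => x; apply: filterS => y; exact: DE.
Qed.

(** Zorn applies because idempotence only relates members of one filter of a
    chain, so that it passes to the union. *)
Lemma exists_maximal_idempotent (F0 : set_system T) :
  ProperFilter F0 -> idempotent_filter F0 ->
  exists F, [/\ ProperFilter F, F0 `<=` F, idempotent_filter F &
    forall G, ProperFilter G -> F `<=` G -> idempotent_filter G -> G = F].
Proof.
move=> F0F F0I.
pose good (F : set_system T) :=
  [/\ ProperFilter F, F0 `<=` F & idempotent_filter F].
have good0 : good F0 by split.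
pose R (F G : {F | good F}) := `[< sval F `<=` sval G >].
have [|||[F [FF F0F' FI]] Fmax] := @ZL_preorder _ (exist _ F0 good0) R.
- by move=> F; exact/asboolP.
- by move=> ? ? ? /asboolP s1 /asboolP s2; exact/asboolP/(subset_trans s1).
- move=> A Atot; have [[F AF]|A0] := pselect (A !=set0); last first.
    by exists (exist _ F0 good0) => F AF; case: A0; exists F.
  have sub G : A G -> sval G `<=` \bigcup_(H in A) sval H.
    by move=> AG D GD; exists G.
  suff gU : good (\bigcup_(H in A) sval H).
    by exists (exist _ _ gU) => G AG; exact/asboolP/sub.
  have [FF F0F' _] := svalP F; split.
  + apply: Build_ProperFilter_ex.
      by move=> D [G _]; have [GF _ _] := svalP G; exact: filter_ex.
    split=> [|D E [G AG GD] [H AH HE]|D E DE [G AG GD]].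
    * by exists F => //; exact: filterT.
    * have [/asboolP GH|/asboolP HG] := Atot _ _ AG AH.
        have [HF _ _] := svalP H; exists H => //.
        by apply: filterI => //; exact: GH.
      have [GF _ _] := svalP G; exists G => //.
      by apply: filterI => //; exact: HG.
    * by have [GF _ _] := svalP G; exists G => //; exact: filterS GD.
  + by move=> D /F0F' FD; exists F.
  + move=> D [G AG GD]; have [GF _ GI] := svalP G.
    exists G => //; have := GI _ GD; rewrite /filter_mul /=.
    by apply: filterS => x GxD; exists G.
exists F; split=> // G GF FG GI.
have gG : good G by split => //; exact: subset_trans FG.
apply/seteqP; split=> //.
by have /asboolP := Fmax (exist _ G gG) (asboolT FG).
Qed.

Hypothesis opA : associative op.

Let shift_mul x y D : op y @^-1` (op x @^-1` D) = op (op x y) @^-1` D.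
Proof. by apply/seteqP; split=> z /=; rewrite opA. Qed.

(** If [X] is the set of all [x] whose shift of [D] lies in [G], then shifting
    [D] by [y] shifts [X] by [y]; so idempotence of [F], applied to [X] in [F],
    already gives the claim. *)
Lemma filter_mul_idempotent (F G : set_system T) :
  ProperFilter F -> ProperFilter G -> F `<=` G -> idempotent_filter F ->
  idempotent_filter (filter_mul F G).
Proof.
move=> FF GF FG FI D FGD.
pose X := [set x | G (op x @^-1` D)].
have FX : F [set y | F (op y @^-1` X)] by exact: FI.
have FXX : F [set x | F (op x @^-1` [set y | F (op y @^-1` X)])] by exact: FI.
rewrite /filter_mul /=; apply: filterS FXX => x Fx.
apply: filterS (FG _ Fx) => y /= Fy.
by apply: filterS Fy => z; rewrite /X /= shift_mul.
Qed.

(** The Ellis-Numakura argument carried out on filters.  Let [U] be an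
    ultrafilter above [F].  The product of [F] and [U] is idempotent, so by
    maximality it is [F]; this plays the part of minimality of the left ideal.
    For [D] in [U] let [d D] be the set of those [x] whose shift of [D] is in
    [U].  The filter generated by [F] and these sets is idempotent as well, so it is [F] again; this plays the part of the
    stabiliser of [U].  Therefore [D] in [U] forces [d D] in [F], that is, [D]
    in the product of [F] and [U], which is [F]. *)
Lemma maximal_idempotent_ultra (F : set_system T) :
  ProperFilter F -> idempotent_filter F ->
  (forall G, ProperFilter G -> F `<=` G -> idempotent_filter G -> G = F) ->
  UltraFilter F.
Proof.
move=> FF FI Fmax.
have [U [UU FU]] := ultraFilterLemma FF.
have FUE : filter_mul F U = F.
  apply: Fmax; first exact: filter_mul_proper.
    move=> D /FI; rewrite /filter_mul /=.
    by apply: filterS => x; exact: FU.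
  exact: filter_mul_idempotent.
pose d D := [set x | U (op x @^-1` D)].
pose H : set_system T := [set E | exists A D, [/\ F A, U D & A `&` d D `<=` E]].
have FH : F `<=` H.
  by move=> A FA; exists A, setT; split; [|exact: filterT|move=> x []].
have HE : H = F.
  apply: Fmax => //.
  - apply: Build_ProperFilter_ex.
      (* If [A] misses [d D], then [A] is inside [d (~` D)], because [U]
         decides every shift of [D]; then [~` D] is in the product, i.e. in
         [F], against [D] in [U]. *)
      move=> E [A [D [FA UD ADE]]]; apply: contrapT => nE.
      have : F (~` D).
        rewrite -FUE /filter_mul /=; apply: filterS FA => x Ax.
        have [|//] := in_ultra_setVsetC (op x @^-1` D) UU.
        by move=> dx; case: nE; exists x; exact: ADE.
      by move=> /FU /(filterI UD); rewrite setICr; exact: filter_not_empty.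
    split=> [|E E' [A [D [FA UD s]]] [A' [D' [FA' UD' s']]]|E E' EE'].
    + by apply: FH; exact: filterT.
    + exists (A `&` A'), (D `&` D'); split; [exact: filterI|exact: filterI|].
      move=> x [[Ax A'x] dx].
      split; [apply: s|apply: s']; split => //.
        by apply: filterS dx => y [].
      by apply: filterS dx => y [].
    + move=> [A [D [FA UD s]]]; exists A, D; split=> //.
      exact: subset_trans EE'.
  - move=> E [A [D [FA UD s]]].
    exists [set x | F (op x @^-1` A)], D; split=> //; first exact: FI.
    move=> x [FxA UxD]; exists (op x @^-1` A), (op x @^-1` D); split => //.
    move=> y [Axy]; rewrite /d /= shift_mul => dy; exact: s.
suff -> : F = U by [].
apply/seteqP; split=> // D UD.
rewrite -FUE; rewrite /filter_mul /= -HE.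
by exists setT, D; split; [exact: filterT| |move=> x []].
Qed.

Theorem exists_idempotent_ultrafilter (F0 : set_system T) :
  ProperFilter F0 -> idempotent_filter F0 ->
  exists F, [/\ UltraFilter F, F0 `<=` F & idempotent_filter F].
Proof.
move=> F0F F0I.
have [F [FF F0F' FI Fmax]] := exists_maximal_idempotent F0F F0I.
by exists F; split=> //; exact: maximal_idempotent_ultra.
Qed.

End IdempotentFilters.

(** * Milliken-Taylor sequences inside an idempotent filter *)

(** The latest move comes first, so that recursion on a history peels off the
    last move. *)
Definition history (T : Type) (w : nat -> T) (n : nat) : seq T :=
  rev (mkseq w n).

Lemma historyS (T : Type) (w : nat -> T) n :
  history w n.+1 = w n :: history w n.
Proof. by rewrite /history mkseqS rev_rcons. Qed.

Section MillikenTaylor.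
Variables (T : eqType) (e : T) (op : Monoid.law e).

(** Moves after which the shifted set can still be offered. *)
Definition legal (p : set_system T) (A : set T) : set T :=
  [set w | A w /\ p (op w @^-1` A)].

(** The Galvin-Glazer refinement: after the move [w], a later product [x] must
    be acceptable both alone and with [w] in front of it.  [E] collects the
    extra demands that depend on the history. *)
Fixpoint available (E : seq T -> set T) (h : seq T) : set T :=
  if h is w :: h' then
    E h `&` (available E h' `&` op w @^-1` available E h')
  else E h.

(** All products of nonempty subsequences of the moves made so far, in the order
    of play. *)
Fixpoint products (h : seq T) : seq T :=
  if h is w :: h' then products h' ++ w :: [seq op u w | u <- products h']
  else [::].

Lemma available_sub E h : available E h `<=` E h.
Proof. by case: h => //= w h x []. Qed.

Section Play.
Variables (p : set_system T) (E : seq T -> set T) (w : nat -> T).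
Hypothesis pF : Filter p.
Hypothesis pE : forall h, p (E h).
(* The hypothesis is conditional so that it makes sense along every history;
   its premise is discharged by induction. *)
Hypothesis wM : forall n, p (available E (history w n)) ->
  legal p (available E (history w n)) (w n).

Lemma filter_available n : p (available E (history w n)).
Proof.
elim: n => [|n IH]; first exact: pE.
rewrite historyS /=; have [_ pw] := wM IH.
by apply: filterI (pE _) _; exact: filterI.
Qed.

Lemma available_le m n : m <= n ->
  available E (history w n) `<=` available E (history w m).
Proof.
elim: n => [|n IH]; first by rewrite leqn0 => /eqP ->.
rewrite leq_eqVlt => /predU1P[-> //|/IH]; apply: subset_trans.
by rewrite historyS => x [_ []].
Qed.

(** By induction from the last factor: the product of the later factors is
    available at a later stage, hence available right after the move [w n],
    which says exactly that prefixing [w n] keeps it available at stage [n]. *)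
Lemma available_product s n : pairwise ltn (n :: s) ->
  available E (history w n) (\big[op/e]_(i <- n :: s) w i).
Proof.
elim: s n => [|m s IH] n.
  by rewrite big_seq1 => _; have [] := wM (filter_available n).
rewrite pairwise_cons /= => /andP[/andP[nm _] ps].
have := available_le nm (IH _ ps).
by rewrite historyS => -[_ [_ ok]]; rewrite big_cons.
Qed.

End Play.

Lemma mem_products w s n : s != [::] -> pairwise ltn s -> all (gtn n) s ->
  \big[op/e]_(i <- s) w i \in products (history w n).
Proof.
elim: n s => [|n IH] s; first by case: s.
rewrite historyS /= mem_cat; case/lastP: s => // s x _.
rewrite pairwise_rcons all_rcons /= => /andP[sx ps] /andP[xn sn].
case: (ltngtP x n) => [lt_xn|lt_nx|xE].
- apply/orP; left; apply: IH.
  + by case: (s).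
  + by rewrite pairwise_rcons sx.
  + rewrite all_rcons /= lt_xn; apply: sub_all sx => y /= yx.
    exact: ltn_trans lt_xn.
- by move: lt_nx; rewrite ltnNge -ltnS xn.
- apply/orP; right; rewrite inE big_rcons /= xE.
  have [->|s0] := eqVneq s [::]; first by rewrite big_nil Monoid.mul1m eqxx.
  apply/orP; right; apply: map_f; apply: IH => //.
  by rewrite -xE; apply: sub_all sx.
Qed.

Lemma filter_seq (p : set_system T) (R : T -> set T) (s : seq T) : Filter p ->
  (forall u, p (R u)) -> p [set v | forall u, u \in s -> R u v].
Proof.
move=> pF pR; elim: s => [|u s IH]; first by apply: filterE.
apply: filterS2 (pR u) IH => v Ruv Rv x; rewrite inE => /predU1P[->//|].
exact: Rv.
Qed.

(** One half of the argument of Galvin and Glazer, left open as a game: [M h] is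
    a whole member of [p] offered after the history [h], so that the choice of
    the actual moves can later serve a different purpose. Membership in [D]
    yields conditions on single products, and [R] conditions on consecutive
    pairs of products. *)
Theorem milliken_taylor_tree (p : set_system T) (D : nat -> set T)
    (R : T -> set T) :
  Filter p -> idempotent_filter op p ->
  (forall n, p (D n)) -> (forall u, p (R u)) ->
  exists2 M : seq T -> set T, forall h, p (M h) &
    forall w, (forall n, M (history w n) (w n)) ->
      (forall n (s : seq nat), pairwise ltn (n :: s) ->
         D n (\big[op/e]_(i <- n :: s) w i)) /\
      (forall s t : seq nat, s != [::] -> t != [::] -> pairwise ltn (s ++ t) ->
         R (\big[op/e]_(i <- s) w i) (\big[op/e]_(i <- t) w i)).
Proof.
move=> pF pI pD pR.
pose E h := D (size h) `&` [set v | forall u, u \in products h -> R u v].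
have pE h : p (E h) by apply: filterI => //; exact: filter_seq.
(* Any move is accepted after a history whose available set is not in [p], so
   that every [M h] belongs to [p]. *)
exists (fun h => [set x | p (available E h) -> legal p (available E h) x]).
  move=> h; have [pA|npA] := pselect (p (available E h)); last first.
    by apply: filterE => x.
  have pAA : p [set x | p (op x @^-1` available E h)] by exact: pI.
  by apply: filterS2 pA pAA => x Ax pAx _; split.
move=> w wM; split=> [n s ns|s [//|m t] s0 _].
  have /available_sub[] := available_product pF pE wM ns.
  by rewrite size_rev size_mkseq.
rewrite pairwise_cat => /and3P[st ps pt].
have /available_sub[_] := available_product pF pE wM pt; apply.
apply: mem_products => //; apply/allP => x xs.
by move: st => /allrelP/(_ x m xs); apply; rewrite inE eqxx.
Qed.

End MillikenTaylor.

(** * Finite lists over an infinite set *)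

(** Comparability of cardinals is the case of two candidates in the principle of
    least cardinality. *)
Lemma card_comparable (T : Type) (A B : set T) : A #<= B \/ B #<= A.
Proof.
have [|D [->|->] minD] := @exists_card_min T [set A; B].
- by exists A; left.
- by left; apply: minD; right.
- by right; apply: minD; left.
Qed.

Lemma card_le_fun (T U : Type) (A : set T) (B : set U) (u0 : U) : A #<= B ->
  exists2 f : T -> U, forall x, A x -> B (f x) & {in A &, injective f}.
Proof.
elim/Ppointed: U => U in B u0 *; first by case: (no u0).
by move=> /pcard_leP; rewrite injfunPex.
Qed.

Lemma inj_card_leT (T U : Type) (f : T -> U) : injective f ->
  [set: T] #<= [set: U].
Proof.
move=> fI; have /card_esym := @inj_card_eq _ _ setT f (in2W fI).
rewrite card_eq_le => /andP[/card_le_trans + _]; apply.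
exact: subset_card_le.
Qed.

Section ListsOverInfiniteSet.
Variable K : Type.
Implicit Types (X Y : set K) (f : seq K -> K) (s t : seq K).

Definition list_in X s : bool := all (fun x => `[< X x >]) s.

Lemma list_in_cat X s t : list_in X (s ++ t) = list_in X s && list_in X t.
Proof. exact: all_cat. Qed.

Lemma list_inW X Y s : X `<=` Y -> list_in X s -> list_in Y s.
Proof. by move=> XY; apply: sub_all => x /asboolP/XY/asboolP. Qed.

Lemma list_in_map X Y (i : K -> K) s :
  (forall x, X x -> Y (i x)) -> list_in X s -> list_in Y (map i s).
Proof.
move=> iXY; rewrite /list_in all_map.
by apply: sub_all => x /asboolP/iXY/asboolP.
Qed.

Lemma map_inj_list_in (U : Type) X (i : K -> U) s t : {in X &, injective i} ->
  list_in X s -> list_in X t -> map i s = map i t -> s = t.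
Proof.
move=> iI; elim: s t => [|x s IH] [|y t] //= /andP[/asboolP Xx Xs].
move=> /andP[/asboolP Xy Xt] [/iI xy /(IH _ Xs Xt) ->].
by rewrite xy ?inE.
Qed.

Definition codes_lists X f :=
  (forall s, list_in X s -> X (f s)) /\
  (forall s t, list_in X s -> list_in X t -> f s = f t -> s = t).

(** A set [Y] whose part outside [X] injects into [X] by [h] still has its lists
    coded in [X]: code a point [y] of [X] by the list [y], any other point by
    the list [h y, h y], turn these short lists into points of [X] by [f], and
    code a list pointwise before applying [f] once more.  The two kinds of
    short lists differ in length. *)
Lemma codes_lists_bigger X f Y (h : K -> K) : codes_lists X f ->
  (forall y, Y y -> ~ X y -> X (h y)) ->
  (forall y z, Y y -> ~ X y -> Y z -> ~ X z -> h y = h z -> y = z) ->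
  exists f' : seq K -> K, (forall s, list_in Y s -> X (f' s)) /\
    (forall s t, list_in Y s -> list_in Y t -> f' s = f' t -> s = t).
Proof.
move=> [fX fI] hX hI.
pose c y := if `[< X y >] then [:: y] else [:: h y; h y].
have cX y : Y y -> list_in X (c y).
  by rewrite /c /list_in; case: asboolP => Xy Yy /=; rewrite ?andbT ?andbb;
    apply/asboolP => //; exact: hX.
have cI y z : Y y -> Y z -> c y = c z -> y = z.
  move=> Yy Yz; rewrite /c; case: asboolP => Xy; case: asboolP => Xz //.
    by case.
  by case=> hyz _; exact: hI hyz.
exists (fun s => f (map (f \o c) s)); split=> [s Ys|s t Ys Yt].
  by apply/fX/(list_in_map _ Ys) => y /cX/fX.
move=> /fI st; apply: (@map_inj_list_in _ Y (f \o c)) => //; last first.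
  by apply: st; [apply: list_in_map Ys|apply: list_in_map Yt] => y /cX/fX.
by move=> y z /set_mem Yy /set_mem Yz /fI /cI; apply => //; exact: cX.
Qed.

Definition extends (q r : set K * (seq K -> K)) :=
  q.1 `<=` r.1 /\ forall s, list_in q.1 s -> q.2 s = r.2 s.

(** The starting point: a countable subset, whose finite lists are countable. *)
Lemma codes_lists_infinite : infinite_set [set: K] ->
  exists X f, codes_lists X f /\ X !=set0.
Proof.
move=> /infiniteP Kinf; have [x0 _] : [set: K] !=set0.
  by apply: infinite_setN0; exact/infiniteP.
have [e _ eI] := card_le_fun x0 Kinf.
have /choice[e' e'K] : forall x, exists n, range e x -> e n = x.
  move=> x; have [[n _ <-]|nx] := pselect (range e x); first by exists n.
  by exists 0.
exists (range e), (fun s => e (pickle (map e' s))).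
split; last by exists (e 0), 0.
split=> [s _|s t es et]; first by exists (pickle (map e' s)).
move=> /eI; rewrite !inE => /(_ I I) /(pcan_inj pickleK).
apply: map_inj_list_in es et.
by move=> x y /set_mem xe /set_mem ye /(congr1 e); rewrite !e'K.
Qed.

(** In the union of a chain, any finite list, and any two of them concatenated,
    already lie over one member of the chain. *)
Lemma codes_lists_maximal X0 f0 : codes_lists X0 f0 ->
  exists X f, [/\ X0 `<=` X, codes_lists X f &
    forall Y g, codes_lists Y g -> extends (X, f) (Y, g) -> Y `<=` X].
Proof.
move=> c0.
pose good (q : set K * (seq K -> K)) := X0 `<=` q.1 /\ codes_lists q.1 q.2.
have good0 : good (X0, f0) by split.
pose R (q r : {q | good q}) := `[< extends (sval q) (sval r) >].
have [|||[[X f] [/= X0X cX]] Xmax] := @ZL_preorder _ (exist _ _ good0) R.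
- by move=> q; apply/asboolP; split.
- move=> r q t /asboolP[s1 e1] /asboolP[s2 e2]; apply/asboolP; split.
    exact: subset_trans s2.
  by move=> s rs; rewrite e1// e2//; exact: list_inW rs.
- move=> A Atot; have [[q0 Aq0]|A0] := pselect (A !=set0); last first.
    by exists (exist _ _ good0) => q Aq; case: A0; exists q.
  pose U := \bigcup_(q in A) (sval q).1.
  have subU q : A q -> (sval q).1 `<=` U by move=> Aq x qx; exists q.
  have overU s : list_in U s -> exists2 q, A q & list_in (sval q).1 s.
    elim: s => [|x s IH] /=; first by exists q0.
    move=> /andP[/asboolP[r Ar rx] /IH[q Aq qs]].
    have [/asboolP[qr _]|/asboolP[rq _]] := Atot _ _ Aq Ar.
      exists r => //; apply/andP; split; first exact/asboolP.
      exact: list_inW qs.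
    by exists q => //; apply/andP; split => //; exact/asboolP/rq.
  have /choice[F FE] : forall s, exists y,
      forall q, A q -> list_in (sval q).1 s -> y = (sval q).2 s.
    move=> s; have [[q [Aq qs]]|nq] :=
      pselect (exists q, A q /\ list_in (sval q).1 s); last first.
      by exists (f0 s) => q Aq qs; case: nq; exists q.
    exists ((sval q).2 s) => r Ar rs.
    by have [/asboolP[_ ->]|/asboolP[_ ->]] := Atot _ _ Aq Ar.
  have gU : good (U, F).
    have [q0X _] := svalP q0.
    split=> /=; first exact: subset_trans (subU _ Aq0).
    split=> [s /overU[q Aq qs]|s t Us Ut].
      rewrite (FE _ _ Aq qs); apply: (subU _ Aq).
      by have [_ [qX _]] := svalP q; exact: qX.
    have /overU[q Aq] : list_in U (s ++ t) by rewrite list_in_cat Us.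
    rewrite list_in_cat => /andP[qs qt].
    by rewrite (FE _ _ Aq qs) (FE _ _ Aq qt); have [_ [_]] := svalP q; exact.
  exists (exist _ _ gU) => q Aq; apply/asboolP; split; first exact: subU.
  by move=> s qs /=; rewrite (FE _ _ Aq qs).
exists X, f; split=> // Y g cY XY.
have gY : good (Y, g) by split=> //=; apply: subset_trans XY.1.
by have /asboolP[] := Xmax (exist _ _ gY) (asboolT XY).
Qed.

(** Take a maximal [X] with a coding of its lists in itself.  If the complement
    of [X] injects into [X], all lists over [K] can be coded in [X].  Otherwise
    the complement contains a copy [h @` X], and the coding extends to the
    union by sending the new lists into that copy, against maximality. *)
Theorem card_seq_le : infinite_set [set: K] -> [set: seq K] #<= [set: K].
Proof.
move=> /codes_lists_infinite[X0 [f0 [c0 [x0 X0x0]]]].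
have [X [f [X0X cX Xmax]]] := codes_lists_maximal c0.
have [le|le] := card_comparable (~` X) X.
  have [h hX hI] := card_le_fun x0 le.
  have [|y z _ nX _ nX'|f' [_ f'I]] := @codes_lists_bigger X f setT h cX.
  - by move=> y _; exact: hX.
  - by apply: hI; rewrite inE.
  have overT s : list_in setT s.
    by elim: s => //= x s ->; rewrite andbT; exact/asboolP.
  by apply: (@inj_card_leT _ _ f') => s t; exact: f'I.
have [h hX hI] := card_le_fun x0 le.
have /choice[h' h'K] : forall y, exists x, (h @` X) y -> X x /\ h x = y.
  move=> y; have [[x Xx <-]|nx] := pselect ((h @` X) y); first by exists x.
  by exists y.
pose Y := X `|` h @` X.
have [y [//|/h'K[] //]|y z|f' [f'X f'I]] := @codes_lists_bigger X f Y h' cX.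
  by move=> [//|/h'K[_ yE]] _ [//|/h'K[_ zE]] _ yz; rewrite -yE -zE yz.
pose g s := if list_in X s then f s else h (f' s).
suff /(Xmax Y g) YX : codes_lists Y g.
  have : X (h x0).
    apply: YX; last by right; exists x0 => //; exact: X0X.
    by split=> [x Xx|s Xs] /=; [left|rewrite /g Xs].
  by have := hX _ (X0X _ X0x0).
have [fX fI] := cX.
split=> [s Ys|s t Ys Yt]; rewrite /g.
  case: ifPn => [/fX|_]; first by left.
  by right; exists (f' s) => //; exact: f'X.
case: ifPn => Xs; case: ifPn => Xt.
- exact: fI.
- by move=> E; have := hX _ (f'X _ Yt); rewrite -E; case; exact: fX.
- by move=> E; have := hX _ (f'X _ Ys); rewrite E; case; exact: fX.
- by move=> /hI E; apply: f'I => //; apply: E; rewrite inE; exact: f'X.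
Qed.

End ListsOverInfiniteSet.

(** * The dominating number and unbounded plays *)

(** [N i h] is the bound that the requirement [i] sets after the history [h] of
    moves.  The possible histories that respect all earlier bounds of [i] are
    finite in number at each stage, so their bounds have a maximum.  A play
    that violates [i] at all stages follows such histories, hence is dominated
    by these maxima; they form a family indexed by [I]. *)
Theorem unbounded_play (I : Type) (N : I -> seq nat -> nat) :
  ~ (frak_d #<= [set: I]) ->
  exists phi : nat -> nat, forall i, exists n, N i (mkseq phi n) <= phi n.
Proof.
move=> dI; apply: contrapT => /forallNP nphi; apply: dI.
pose top i (L : seq (seq nat)) := \max_(h <- L) N i h.
pose level i := fix level n : seq (seq nat) :=
  if n is n'.+1 then
    let L := level n' in [seq rcons h j | h <- L, j <- iota 0 (top i L).+1]
  else [:: [::]].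
have le_top i n h : h \in level i n -> N i h <= top i (level i n).
  by move=> hL; exact: leq_bigmax_seq.
have dom : dominating (range (fun i n => top i (level i n))).
  move=> phi; have /existsNP[i /forallNP lt_phi] := nphi phi.
  exists (fun n => top i (level i n)); first by exists i.
  have phi_level n : mkseq phi n \in level i n.
    elim: n => [|n IH]; first by rewrite inE.
    rewrite mkseqS; apply/allpairsP; exists (mkseq phi n, phi n); split=> //.
    rewrite mem_iota /= add0n ltnS; apply: leq_trans (le_top _ _ _ IH).
    by apply/ltnW; rewrite ltnNge; exact/negP.
  move=> n; apply: leq_trans (le_top _ _ _ (phi_level n)).
  by apply/ltnW; rewrite ltnNge; exact/negP.
exact: card_le_trans (frak_d_min dom) (card_image_le _ _).
Qed.

(** * Gamma sequences of words *)

Definition word_union (K : Type) (B : nat -> set K) (v : seq nat) : set K :=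
  \bigcup_(m in [set` v]) B m.

Lemma word_union_cat (K : Type) (B : nat -> set K) (u v : seq nat) :
  word_union B (u ++ v) = word_union B u `|` word_union B v.
Proof.
rewrite /word_union -bigcup_setU; congr bigcup.
apply/seteqP; split=> m /=; rewrite mem_cat => /orP //.
Qed.

Lemma word_union_big (K : Type) (B : nat -> set K) (w : nat -> seq nat)
    (s : seq nat) :
  word_union B (\big[cat/[::]]_(i <- s) w i) =
  \bigcup_(i in [set` s]) word_union B (w i).
Proof.
elim: s => [|i s IH].
  by rewrite big_nil; apply/seteqP; split=> x [].
rewrite big_cons word_union_cat IH; apply/seteqP; split=> x.
  move=> [wx|[j js wx]]; first by exists i; rewrite //= inE eqxx.
  by exists j => //=; rewrite inE js orbT.
move=> [j /=]; rewrite inE => /predU1P[->|js] wx; first by left.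
by right; exists j.
Qed.

Section GammaSequences.
Variables (K : Type) (B : nat -> set K) (J : nat -> set nat).
Hypothesis J_decr : forall n, J n.+1 `<=` J n.
Hypothesis J_large : forall n x N, exists m, [/\ N <= m, J n m & B m x].

Definition gamma_sequence (g : nat -> seq nat) : Prop :=
  forall x, \forall j \near \oo, word_union B (g j) x.

(** The empty word is excluded because the selected families have to be
    nonempty. *)
Definition words_from (n : nat) : set (seq nat) :=
  [set v | v != [::] /\ forall m, m \in v -> n <= m /\ J n m].

(** The sets that no gamma sequence drawn from a late enough [words_from n]
    leaves infinitely often. Their duals are the sets that contain gamma
    sequences from every [words_from n]. *)
Definition gamma_filter : set_system (seq nat) :=
  [set D | exists n, forall g, (forall j, words_from n (g j)) ->
     gamma_sequence g -> \forall j \near \oo, D (g j)].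

Lemma words_from_le m n : m <= n -> words_from n `<=` words_from m.
Proof.
move=> mn; have Jmn : J n `<=` J m.
  elim: n mn => [|n IH]; first by rewrite leqn0 => /eqP ->.
  rewrite leq_eqVlt => /predU1P[-> //|/IH]; apply: subset_trans.
  exact: J_decr.
move=> v [v0 vn]; split=> // a /vn[na /Jmn Ja]; split=> //.
exact: leq_trans na.
Qed.

(** Longer and longer initial segments of the tail of [J n] beyond [n]; the
    letter [m0] only ensures that the first segments are nonempty. *)
Lemma exists_gamma_sequence (x0 : K) n :
  exists2 g, gamma_sequence g & forall j, words_from n (g j).
Proof.
have [m0 [nm0 Jm0 _]] := J_large n x0 n.
exists (fun j => m0 :: [seq m <- iota n j | `[< J n m >]]).
  move=> x; have [m [nm Jm Bx]] := J_large n x n.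
  exists m.+1 => // j /= mj; exists m => //=.
  rewrite inE mem_filter mem_iota nm (leq_trans mj (leq_addl _ _)) !andbT.
  by apply/orP; right; exact/asboolP.
move=> j; split=> // m; rewrite inE mem_filter mem_iota => /predU1P[-> //|].
by move=> /andP[/asboolP Jm /andP[]].
Qed.

Lemma gamma_filter_proper : K -> ProperFilter gamma_filter.
Proof.
move=> x0; apply: Build_ProperFilter_ex.
  move=> D [n nD]; have [g gg gn] := exists_gamma_sequence x0 n.
  by have /filter_ex[j] := nD g gn gg; exists (g j).
split=> [|D E [m mD] [n nE]|D E DE [n nD]].
- by exists 0 => g _ _; exact: filterE.
- exists (maxn m n) => g gC gg.
  by apply: filterI; [apply: mD => // j|apply: nE => // j];
    apply: words_from_le (gC j); rewrite ?leq_maxl ?leq_maxr.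
- by exists n => g gC gg; apply: filterS (nD g gC gg) => j; exact: DE.
Qed.

Lemma gamma_filter_words n : gamma_filter (words_from n).
Proof. by exists n => g gC _; exact: filterE. Qed.

Lemma gamma_filter_point x : gamma_filter [set v | word_union B v x].
Proof. by exists 0 => g _ /(_ x). Qed.

(** Prefixing a fixed word of [words_from n] keeps a sequence in [words_from n]
    and keeps it gamma, so the shift of [D] by that word works with the same
    [n] as [D]. *)
Lemma gamma_filter_idempotent : K -> idempotent_filter cat gamma_filter.
Proof.
move=> x0 D [n nD]; have FF := gamma_filter_proper x0.
rewrite /filter_mul /=; apply: filterS (gamma_filter_words n) => u [u0 uC].
exists n => g gC gg; apply: (nD (fun j => u ++ g j)) => [j|x].
  have [g0 gj] := gC j; split; first by case: (u) u0.
  by move=> m; rewrite mem_cat => /orP[/uC|/gj].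
by apply: filterS (gg x) => j gx; rewrite word_union_cat; right.
Qed.

(** A gamma sequence that returns to [D] infinitely often can be reindexed to
    stay inside [D], and it remains gamma since the indices tend to infinity. *)
Lemma gamma_filter_meets (D : set (seq nat)) : ~ gamma_filter (~` D) ->
  exists2 g, gamma_sequence g & forall j, D (g j).
Proof.
move=> /forallNP/(_ 0) /existsNP[g /not_implyP[_ /not_implyP[gg nev]]].
have /choice[r rP] : forall N, exists j, N <= j /\ D (g j).
  move=> N; apply: contrapT => nj; apply: nev; exists N => // j /= Nj Dj.
  by apply: nj; exists j.
exists (g \o r) => [x|N]; last by have [] := rP N.
have [N _ gN] := gg x; exists N => // j /= Nj; apply: gN => /=.
by have [+ _] := rP j; exact: leq_trans.
Qed.

Lemma exists_gamma_ultrafilter : K -> exists p : set_system (seq nat),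
  [/\ UltraFilter p, idempotent_filter cat p, gamma_filter `<=` p &
      forall D, p D -> exists2 g, gamma_sequence g & forall j, D (g j)].
Proof.
move=> x0; have FF := gamma_filter_proper x0.
have [p [pU Fp pI]] := exists_idempotent_ultrafilter (@catA nat) FF
  (gamma_filter_idempotent x0).
exists p; split=> // D pD; apply: gamma_filter_meets => /Fp/(filterI pD).
by rewrite setICr; exact: filter_not_empty.
Qed.

End GammaSequences.

Lemma ultra_color (T : Type) (C : finType) (p : set_system T)
    (Q : C -> set T) :
  UltraFilter p -> p [set v | exists c, Q c v] -> exists c, p (Q c).
Proof.
move=> pU pQ; apply: contrapT => /forallNP nQ.
have : \forall v \near p, forall c, ~ Q c v.
  by apply: filter_forall => c; have [/nQ|] := in_ultra_setVsetC (Q c) pU.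
by move=> /(filterI pQ)/filter_ex[v [[c Qcv] /(_ c)]].
Qed.

Lemma card_set2_neq (T : Type) (a b : T) : a <> b -> [set a; b] #= `I_2.
Proof.
move=> ab; apply/eq_cardSP; exists a; first by left.
rewrite [X in X #= _](_ : _ = [set b]); first exact: card_set1.
apply/seteqP; split=> x /=; first by case=> -[].
by move=> ->; split; [right|exact/nesym].
Qed.

Lemma finite_increasing (F : set nat) : finite_set F ->
  exists2 s : seq nat, F = [set` s] & pairwise ltn s.
Proof.
move=> /finite_seqP[s ->]; exists (sort leq (undup s)).
  by apply/seteqP; split=> n /=; rewrite mem_sort mem_undup.
rewrite -(sorted_pairwise ltn_trans) ltn_sorted_uniq_leq sort_uniq undup_uniq.
exact/sort_sorted/leq_total.
Qed.

(** * Selecting the finite subfamilies *)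

Section Selection.
Variables (K : choiceType) (U : nat -> set (set K)) (B : nat -> set K).
Hypothesis hK : card_lt [set: K] frak_d.
Hypothesis U_decr : forall n, U n.+1 `<=` U n.
Hypothesis U_point_infinite : forall n, point_infinite (U n).
Hypothesis U_no_finite_subcover : forall n, ~ has_finite_subcover (U n).
Hypothesis U_cover : forall n, is_cover (U n).
Hypothesis B_inj : injective B.
Hypothesis B_range : range B = U 0.

Let J n : set nat := [set m | U n (B m)].

Let U_sub n : U n `<=` U 0.
Proof. elim: n => [|n IH]; first by []. exact: (subset_trans (@U_decr n)). Qed.

Let J_large n x N : exists m, [/\ N <= m, J n m & B m x].
Proof.
apply: contrapT => nm; apply: (@U_point_infinite n x).
apply: (@sub_finite_set _ _ (B @` `I_N)); last exact/finite_image/finite_II.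
move=> X /= [UX Xx]; have := U_sub UX; rewrite -B_range => -[m _ mX].
exists m => //=; rewrite ltnNge; apply/negP => Nm.
by apply: nm; exists m; rewrite /J /= mX.
Qed.

Let word_union_proper v : exists x, ~ word_union B v x.
Proof.
apply/existsNP => vT; apply: (U_no_finite_subcover (n := 0)).
exists (B @` [set` v]); split.
- by move=> _ [m _ <-]; rewrite -B_range; exists m.
- exact/finite_image/finite_seq.
- rewrite /is_cover /cover bigcup_image; apply/seteqP; split=> // x _.
  exact: vT.
Qed.

Let K_infinite : infinite_set [set: K].
Proof.
move=> Kfin; have /choice[X XP] : forall x, exists X, U 0 X /\ X x.
  move=> x; have : cover (U 0) id x by rewrite U_cover.
  by move=> [X UX Xx]; exists X.
apply: (U_no_finite_subcover (n := 0)); exists (range X); split.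
- by move=> _ [x _ <-]; have [] := XP x.
- exact: finite_image.
- by apply/seteqP; split=> // x _; exists (X x) => //; have [] := XP x.
Qed.

Variables (k : nat) (chi1 : set K -> 'I_k) (chi2 : two_subsets (set K) -> 'I_k).

Definition pair_color (u v : seq nat) (c : 'I_k) : Prop :=
  exists2 q : two_subsets (set K),
    val q = [set word_union B u; word_union B v] & chi2 q = c.

(** The point outside the first union makes the two unions distinct; the order
    of letters makes the selected families disjoint and consecutive. *)
Definition fresh (u v : seq nat) : Prop :=
  (exists2 x, word_union B v x & ~ word_union B u x) /\
  (forall a b, a \in u -> b \in v -> a < b).

Lemma fresh_near (p : set_system (seq nat)) u : Filter p ->
  gamma_filter B J `<=` p -> p (fresh u).
Proof.
move=> pF Gp; have [x ux] := word_union_proper u.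
have px := Gp _ (@gamma_filter_point _ B J x).
have pn := Gp _ (@gamma_filter_words _ B J (\max_(a <- u) a).+1).
apply: filterS2 px pn => v vx [_ vn]; split; first by exists x.
move=> a b au /vn[+ _]; apply: leq_trans; rewrite ltnS.
exact: leq_bigmax_seq.
Qed.

Lemma fresh_neq u v : fresh u v -> word_union B u <> word_union B v.
Proof. by move=> [[x vx ux] _] uv; apply: ux; rewrite uv. Qed.

Lemma exists_pair_color (p : set_system (seq nat)) u : UltraFilter p ->
  gamma_filter B J `<=` p -> exists c, p [set v | pair_color u v c].
Proof.
move=> pU Gp; apply: ultra_color; apply: filterS (fresh_near u _ Gp) => v uv.
have q2 : [set word_union B u; word_union B v] \in two_subsets (set K).
  by apply/mem_set/card_set2_neq/fresh_neq.
by exists (chi2 (SigSub q2)), (SigSub q2).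
Qed.

(** Following a gamma sequence inside [M h] turns a move into a natural number,
    and for each finite list of points all large moves succeed; the number of
    finite lists is below the dominating number. *)
Lemma exists_game_words (M : seq (seq nat) -> set (seq nat)) :
  (forall h, exists2 g, gamma_sequence B g & forall j, M h (g j)) ->
  exists2 w : nat -> seq nat, forall n, M (history w n) (w n) &
    forall S : seq K, exists n, list_in (word_union B (w n)) S.
Proof.
move=> Mg; have /choice[g gP] : forall h, exists g,
    gamma_sequence B g /\ forall j, M h (g j).
  by move=> h; have [g] := Mg h; exists g.
pose play (s : seq nat) := foldl (fun h j => g h j :: h) [::] s.
have g_near h (S : seq K) :
    \forall j \near \oo, list_in (word_union B (g h j)) S.
  elim: S => [|x S IH]; first exact: filterE.
  have [/(_ x) gx _] := gP h; apply: filterS2 gx IH => j jx jS /=.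
  by rewrite jS andbT; exact/asboolP.
have /choice[N NP] : forall Ss : seq K * seq nat, exists N, forall j,
    N <= j -> list_in (word_union B (g (play Ss.2) j)) Ss.1.
  by move=> [S s]; have [n _ nP] := g_near (play s) S; exists n => j; exact: nP.
have dK : ~ (frak_d #<= [set: seq K]).
  by move=> /card_le_trans/(_ (card_seq_le K_infinite)); case: hK.
have [phi phiP] := unbounded_play (fun S s => N (S, s)) dK.
pose w n := g (play (mkseq phi n)) (phi n).
have historyE n : history w n = play (mkseq phi n).
  elim: n => // n IH; rewrite historyS IH mkseqS /play foldl_rcons.
  by rewrite -/(play _).
exists w => [n|S].
  by rewrite historyE; have [_] := gP (play (mkseq phi n)); exact.
by have [n /NP] := phiP S; exists n.
Qed.

Theorem selection_of_enumeration : exists Fam : nat -> set (set K),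
  [/\ disjoint_selection U Fam,
      hindman_ramsey chi1 chi2 (fun n => \bigcup_(X in Fam n) X) &
      forall n, set_before [set m | Fam n (B m)] [set m | Fam n.+1 (B m)]].
Proof.
have [x0 _] := infinite_setN0 K_infinite.
have J_decr n : J n.+1 `<=` J n by move=> m; exact: U_decr.
have [p [pU pI Gp pg]] := exists_gamma_ultrafilter J_decr J_large x0.
(* [c1] is the color of the single unions, [c u] the color of the pairs that
   start with [u], and [c2] the value of [c] on a member of [p]. *)
have [c1 pc1] : exists c1, p [set v | chi1 (word_union B v) = c1].
  apply: ultra_color; apply: filterE => v; by exists (chi1 (word_union B v)).
have /choice[c cP] := fun u => exists_pair_color u pU Gp.
have [c2 pc2] : exists c2, p [set u | c u = c2].
  by apply: ultra_color; apply: filterE => u; exists (c u).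
pose D n := words_from J n `&`
  ([set v | chi1 (word_union B v) = c1] `&` [set u | c u = c2]).
pose R u := fresh u `&` [set v | pair_color u v (c u)].
have pD n : p (D n).
  by apply: filterI; [exact: Gp (gamma_filter_words _ _ _)|exact: filterI].
have pR u : p (R u) by apply: filterI; [exact: fresh_near|exact: cP].
have [M pM MP] := milliken_taylor_tree (op := @cat nat) _ pI pD pR.
have [w wM w_over] := exists_game_words (fun h => pg _ (pM h)).
have [wD wR] := MP w wM.
have wJ n : words_from J n (w n).
  by have [//|+ _] := wD n [::]; rewrite big_seq1.
have w_lt m n a b : m < n -> a \in w m -> b \in w n -> a < b.
  move=> mn wa wb; have := wR [:: m] [:: n]; rewrite !big_seq1 /= mn.
  by case=> // -[_ +] _; exact.
pose Fam n := B @` [set` w n].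
have FamE n : \bigcup_(X in Fam n) X = word_union B (w n).
  by rewrite /Fam bigcup_image.
have unionE s : union_over (fun n => \bigcup_(X in Fam n) X) [set` s] =
    word_union B (\big[cat/[::]]_(i <- s) w i).
  by rewrite word_union_big; apply: eq_bigcupr => n _; exact: FamE.
have increasing F : fin_nonempty F ->
    exists2 s : seq nat, F = [set` s] & pairwise ltn s && (s != [::]).
  move=> [/finite_increasing[s -> ps] [n /= ns]]; exists s => //.
  by rewrite ps; apply: contraTneq (ns : n \in s) => ->.
have increasing2 F H : fin_nonempty F -> fin_nonempty H -> set_before F H ->
    exists s t : seq nat, [/\ F = [set` s], H = [set` t], s != [::], t != [::] &
      pairwise ltn (s ++ t)].
  move=> /increasing[s -> /andP[ps s0]] /increasing[t -> /andP[pt t0]] st.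
  exists s, t; split=> //; rewrite pairwise_cat ps pt !andbT.
  by apply/allrelP => m n ms nt; exact: st.
have w_color s : pairwise ltn s -> s != [::] ->
    [/\ chi1 (word_union B (\big[cat/[::]]_(i <- s) w i)) = c1 &
        c (\big[cat/[::]]_(i <- s) w i) = c2].
  by case: s => // n s ns _; have [_ []] := wD n s ns.
exists Fam; split; last first.
- move=> n a b [a' wa /B_inj <-] [b' wb /B_inj <-].
  exact: w_lt (ltnSn n) wa wb.
- split.
  + move=> S /finite_seqP[s ->]; have [n ns] := w_over s.
    by exists n => x xs; rewrite FamE; apply/asboolP; exact: (allP ns).
  + move=> F H FF HF FH.
    have [s [t [-> -> s0 t0 st]]] := increasing2 F H FF HF FH.
    by rewrite !unionE; apply: fresh_neq; have [] := wR s t s0 t0 st.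
  + exists c1 => F /increasing[s -> /andP[ps s0]].
    by rewrite unionE; have [] := w_color s ps s0.
  + exists c2 => F H FF HF FH.
    have [s [t [-> -> s0 t0 st]]] := increasing2 F H FF HF FH.
    rewrite !unionE; have [_] := wR s t s0 t0 st.
    by move: st; rewrite pairwise_cat => /and3P[_ /w_color/(_ s0)[_ ->]].
- split.
  + by move=> n _ [m wm <-]; have [_ /(_ m wm)[]] := wJ n.
  + by move=> n; apply/finite_image/finite_seq.
  + move=> n; have [w0 _] := wJ n.
    rewrite /Fam; case: (w n) w0 => // m v _.
    by exists (B m), m => //; exact: mem_head.
  + move=> m n _ _ [_ [[a wa <-] [b wb /B_inj ba]]]; subst b.
    by case: (ltngtP m n) => // mn; have := w_lt _ _ _ _ mn; [
      move=> /(_ a a wa wb)|move=> /(_ a a wb wa)]; rewrite ltnn.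
Qed.

End Selection.

Theorem theorem6p1 (K : Type) (hK : card_lt [set: K] frak_d)
    (U : nat -> set (set K))
    (U_decr : forall n, U n.+1 `<=` U n)
    (U_countable : forall n, countable (U n))
    (U_cover : forall n, is_cover (U n))
    (U_point_infinite : forall n, point_infinite (U n))
    (U_no_finite_subcover : forall n, ~ has_finite_subcover (U n))
    (k : nat) (chi1 : set K -> 'I_k) (chi2 : two_subsets (set K) -> 'I_k) :
  (exists Fam : nat -> set (set K),
     disjoint_selection U Fam /\
     hindman_ramsey chi1 chi2 (fun n => \bigcup_(X in Fam n) X)) /\
  (forall B : nat -> set K, injective B -> range B = U 0 ->
     exists Fam : nat -> set (set K),
       [/\ disjoint_selection U Fam,
           hindman_ramsey chi1 chi2 (fun n => \bigcup_(X in Fam n) X) &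
           forall n, set_before [set m | Fam n (B m)]
                                [set m | Fam n.+1 (B m)]]).
Proof.
elim/Pchoice: K => K in hK U U_decr U_countable U_cover U_point_infinite
  U_no_finite_subcover chi1 chi2 *.
have enum (B : nat -> set K) : injective B -> range B = U 0 -> _ :=
  fun BI BU => selection_of_enumeration hK U_decr U_point_infinite
    U_no_finite_subcover U_cover BI BU chi1 chi2.
split=> //.
have [x _] : [set: K] !=set0.
  apply: contrapT => /set0P/negP/negPn/eqP K0.
  apply: (U_no_finite_subcover 0); exists set0; split=> //.
  by rewrite /is_cover K0; apply/seteqP; split=> x // [].
have U_inf : infinite_set (U 0).
  by move=> fU; apply: (U_point_infinite 0 x); apply: sub_finite_set fU => X [].
have : [set: nat] #= U 0.
  by rewrite card_eq_le; apply/andP; split; [exact/infiniteP|exact: U_countable].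
move=> /card_set_bijP[B [BU BI BS]].
have [||Fam [sel hr _]] := enum B.
- by move=> m n; apply: BI; rewrite inE.
- by apply/seteqP; split=> [_ [n _ <-]|X /BS[n _ <-]]; [exact: BU|exists n].
by exists Fam.
Qed.
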